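(* Let $m\ge1$ and let $e_{kl}^p,\tilde e_{kl}^p,c_p,\tilde c_p\in U(\mathfrak{gl}(m,\mathbb{C}))$ be as in the context. Then for all $q\in\mathbb{Z}_{\ge0}$ and $k,l\in\{1,\dots,m\}$, the following identities hold in $U(\mathfrak{gl}(m,\mathbb{C}))$: $$\sum_{p=0}^q\binom{q}{p}(-m)^{q-p}\,\tilde e_{kl}^p=(-1)^q\sum_{p=0}^qK_{q-p}(-c)\,e_{lk}^p,$$ $$\sum_{p=0}^q\binom{q}{p}(-m)^{q-p}\,e_{kl}^p=(-1)^q\sum_{p=0}^qK_{q-p}(-\tilde c)\,\tilde e_{lk}^p,$$ where $$K_n(-c)=\sum_{i_1+2i_2+\cdots+ni_n=n}\frac{(i_1+i_2+\cdots+i_n)!}{i_1!\,i_2!\cdots i_n!}\,c_0^{i_1}c_1^{i_2}\cdots c_{n-1}^{i_n}$$ (the sum over non-negative integers $i_1,\dots,i_n$, with $K_0(-c)=1$), and $K_n(-\tilde c)$ is the same polynomial with each $c_j$ replaced by $\tilde c_j$.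
   Context: $U(\mathfrak{gl}(m,\mathbb{C}))$ is the universal enveloping algebra of $\mathfrak{gl}(m,\mathbb{C})$ and $e_{kl}$ is the $m\times m$ matrix with $1$ in place $(k,l)$ and $0$ elsewhere. Put $e_{kl}^0:=\tilde e_{kl}^0:=\delta_{kl}$ and for $q\ge1$ $$e_{kl}^q:=\sum_{1\le i_1,\dots,i_{q-1}\le m}e_{ki_1}e_{i_1i_2}\cdots e_{i_{q-1}l},\qquad \tilde e_{kl}^q:=(-1)^q\sum_{1\le i_1,\dots,i_{q-1}\le m}e_{i_1k}e_{i_2i_1}\cdots e_{li_{q-1}}$$ (so $e_{kl}^1=e_{kl}$, $\tilde e_{kl}^1=-e_{lk}$). Put $c_q:=\sum_k e_{kk}^q$ and $\tilde c_q:=\sum_k\tilde e_{kk}^q$; these are central elements, and $c_0=\tilde c_0=m$. *)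

(* Defs.v *)
From HB Require Import structures.
From mathcomp Require Import all_boot all_order all_algebra.
From mathcomp Require Import boolp reals complex.

Set Implicit Arguments.
Unset Strict Implicit.
Unset Printing Implicit Defensive.

Import GRing.Theory.
Local Open Scope ring_scope.
Local Open Scope quotient_scope.

(* Universal enveloping algebra of a Lie algebra (L, br) over a commutative   *)
(* ring K, presented by generators and relations: the terms of the signature  *)
(* of unital associative K-algebras over the generators x : L, modulo the     *)
(* smallest congruence that contains the algebra axioms, the K-linearity of   *)
(* L -> U, and [x, y] = x y - y x. The Lie axioms on br play no role in the   *)
(* construction. The universal property is uenv_universal below.              *)
Section UniversalEnvelopingAlgebra.
Variables (K : comNzRingType) (L : lmodType K) (br : L -> L -> L).

Inductive uterm : Type :=
| UGen of L
| UZero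
| UOne
| UAdd of uterm & uterm
| UMul of uterm & uterm
| UScale of K & uterm.

HB.instance Definition _ := gen_eqMixin uterm.
HB.instance Definition _ := gen_choiceMixin uterm.

Inductive ueq : uterm -> uterm -> Prop :=
| ueq_refl s : ueq s s
| ueq_sym s t : ueq s t -> ueq t s
| ueq_trans t s u : ueq s t -> ueq t u -> ueq s u
| ueq_add s s' t t' : ueq s s' -> ueq t t' -> ueq (UAdd s t) (UAdd s' t')
| ueq_mul s s' t t' : ueq s s' -> ueq t t' -> ueq (UMul s t) (UMul s' t')
| ueq_scale a s s' : ueq s s' -> ueq (UScale a s) (UScale a s')
| ueq_addA s t u : ueq (UAdd s (UAdd t u)) (UAdd (UAdd s t) u)
| ueq_addC s t : ueq (UAdd s t) (UAdd t s)
| ueq_add0 s : ueq (UAdd UZero s) s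
| ueq_addN s : ueq (UAdd (UScale (-1) s) s) UZero
| ueq_mulA s t u : ueq (UMul s (UMul t u)) (UMul (UMul s t) u)
| ueq_mul1l s : ueq (UMul UOne s) s
| ueq_mul1r s : ueq (UMul s UOne) s
| ueq_mulDl s t u : ueq (UMul (UAdd s t) u) (UAdd (UMul s u) (UMul t u))
| ueq_mulDr s t u : ueq (UMul s (UAdd t u)) (UAdd (UMul s t) (UMul s u))
| ueq_scaleA a b s : ueq (UScale a (UScale b s)) (UScale (a * b) s)
| ueq_scale1 s : ueq (UScale 1 s) s
| ueq_scaleDr a s t : ueq (UScale a (UAdd s t)) (UAdd (UScale a s) (UScale a t))
| ueq_scaleDl a b s : ueq (UScale (a + b) s) (UAdd (UScale a s) (UScale b s))
| ueq_scaleAl a s t : ueq (UScale a (UMul s t)) (UMul (UScale a s) t)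
| ueq_scaleAr a s t : ueq (UScale a (UMul s t)) (UMul s (UScale a t))
| ueq_gen_lin a x y :
    ueq (UGen (a *: x + y)) (UAdd (UScale a (UGen x)) (UGen y))
| ueq_gen_br x y :
    ueq (UGen (br x y))
        (UAdd (UMul (UGen x) (UGen y)) (UScale (-1) (UMul (UGen y) (UGen x)))).

Definition ueqb : rel uterm := fun s t => `[< ueq s t >].

Lemma ueqb_equiv : equiv_class_of ueqb.
Proof.
split=> [s|s t|t s u].
- exact/asboolP/ueq_refl.
- by apply/asboolP/asboolP; apply: ueq_sym.
- by move=> /asboolP st /asboolP tu; apply/asboolP/(ueq_trans st tu).
Qed.

Canonical ueqb_equiv_rel := EquivRelPack ueqb_equiv.

Definition uenv : Type := {eq_quot ueqb}.

HB.instance Definition _ : EqQuotient _ ueqb uenv := EqQuotient.on uenv.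
HB.instance Definition _ := Choice.on uenv.

Definition ucls (t : uterm) : uenv := \pi_uenv t.

Lemma uclsP s t : ucls s = ucls t <-> ueq s t.
Proof.
split=> [/eqmodP/asboolP //|st].
by apply/eqmodP/asboolP.
Qed.

Lemma ucls_ind (P : uenv -> Prop) : (forall t, P (ucls t)) -> forall u, P u.
Proof. by move=> Pt u; rewrite -[u]reprK. Qed.

Lemma ucls_repr t : ueq (repr (ucls t)) t.
Proof. by apply/uclsP; rewrite /ucls reprK. Qed.

Definition uenv_add (u v : uenv) : uenv := ucls (UAdd (repr u) (repr v)).
Definition uenv_mul (u v : uenv) : uenv := ucls (UMul (repr u) (repr v)).
Definition uenv_scale a (u : uenv) : uenv := ucls (UScale a (repr u)).

Lemma ucls_add s t : uenv_add (ucls s) (ucls t) = ucls (UAdd s t).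
Proof. by apply/uclsP/ueq_add; apply: ucls_repr. Qed.

Lemma ucls_mul s t : uenv_mul (ucls s) (ucls t) = ucls (UMul s t).
Proof. by apply/uclsP/ueq_mul; apply: ucls_repr. Qed.

Lemma ucls_scale a s : uenv_scale a (ucls s) = ucls (UScale a s).
Proof. by apply/uclsP/ueq_scale; apply: ucls_repr. Qed.

Definition uclsE := (ucls_add, ucls_mul, ucls_scale).

Fact uenv_addA : associative uenv_add.
Proof.
elim/ucls_ind=> s; elim/ucls_ind=> t; elim/ucls_ind=> u.
by rewrite !uclsE; apply/uclsP/ueq_addA.
Qed.

Fact uenv_addC : commutative uenv_add.
Proof.
elim/ucls_ind=> s; elim/ucls_ind=> t.
by rewrite !uclsE; apply/uclsP/ueq_addC.
Qed.

Fact uenv_add0 : left_id (ucls UZero) uenv_add.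
Proof. by elim/ucls_ind=> s; rewrite !uclsE; apply/uclsP/ueq_add0. Qed.

Fact uenv_addN : left_inverse (ucls UZero) (uenv_scale (-1)) uenv_add.
Proof. by elim/ucls_ind=> s; rewrite !uclsE; apply/uclsP/ueq_addN. Qed.

HB.instance Definition _ :=
  GRing.isZmodule.Build uenv uenv_addA uenv_addC uenv_add0 uenv_addN.

Fact uenv_mulA : associative uenv_mul.
Proof.
elim/ucls_ind=> s; elim/ucls_ind=> t; elim/ucls_ind=> u.
by rewrite !uclsE; apply/uclsP/ueq_mulA.
Qed.

Fact uenv_mul1l : left_id (ucls UOne) uenv_mul.
Proof. by elim/ucls_ind=> s; rewrite !uclsE; apply/uclsP/ueq_mul1l. Qed.

Fact uenv_mul1r : right_id (ucls UOne) uenv_mul.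
Proof. by elim/ucls_ind=> s; rewrite !uclsE; apply/uclsP/ueq_mul1r. Qed.

Fact uenv_mulDl : left_distributive uenv_mul uenv_add.
Proof.
elim/ucls_ind=> s; elim/ucls_ind=> t; elim/ucls_ind=> u.
by rewrite !uclsE; apply/uclsP/ueq_mulDl.
Qed.

Fact uenv_mulDr : right_distributive uenv_mul uenv_add.
Proof.
elim/ucls_ind=> s; elim/ucls_ind=> t; elim/ucls_ind=> u.
by rewrite !uclsE; apply/uclsP/ueq_mulDr.
Qed.

Fixpoint ueval (B : algType K) (f : L -> B) (t : uterm) : B :=
  match t with
  | UGen x => f x
  | UZero => 0
  | UOne => 1
  | UAdd s t => ueval f s + ueval f t
  | UMul s t => ueval f s * ueval f t
  | UScale a s => a *: ueval f s
  end.

Lemma ueval_eq (B : algType K) (f : L -> B) s t :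
  linear f -> (forall x y, f (br x y) = f x * f y - f y * f x) ->
  ueq s t -> ueval f s = ueval f t.
Proof.
move=> flin fbr; elim=> //= {s t}.
- by move=> t s u _ -> _ ->.
- by move=> s s' t t' _ -> _ ->.
- by move=> s s' t t' _ -> _ ->.
- by move=> a s s' _ ->.
- by move=> s t u; rewrite addrA.
- by move=> s t; rewrite addrC.
- by move=> s; rewrite add0r.
- by move=> s; rewrite scaleN1r addNr.
- by move=> s t u; rewrite mulrA.
- by move=> s; rewrite mul1r.
- by move=> s; rewrite mulr1.
- by move=> s t u; rewrite mulrDl.
- by move=> s t u; rewrite mulrDr.
- by move=> a b s; rewrite scalerA.
- by move=> s; rewrite scale1r.
- by move=> a s t; rewrite scalerDr.
- by move=> a b s; rewrite scalerDl.
- by move=> a s t; rewrite scalerAl.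
- by move=> a s t; rewrite scalerAr.
- by move=> x y; rewrite fbr scaleN1r.
Qed.

Fact uenv_oner_neq0 : ucls UOne != 0 :> uenv.
Proof.
apply/eqP => /uclsP E.
have := @ueval_eq K^o (fun=> 0) _ _ _ _ E => /= /(_ _ _)/eqP.
rewrite (negbTE (oner_neq0 _)) => F; apply/notF/F => [a x y|x y].
  by rewrite scaler0 addr0.
by rewrite mul0r subr0.
Qed.

HB.instance Definition _ := GRing.Zmodule_isNzRing.Build uenv
  uenv_mulA uenv_mul1l uenv_mul1r uenv_mulDl uenv_mulDr uenv_oner_neq0.

Fact uenv_scaleA a b u : uenv_scale a (uenv_scale b u) = uenv_scale (a * b) u.
Proof. by elim/ucls_ind: u => s; rewrite !uclsE; apply/uclsP/ueq_scaleA. Qed.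

Fact uenv_scale1 : left_id 1 uenv_scale.
Proof. by elim/ucls_ind=> s; rewrite !uclsE; apply/uclsP/ueq_scale1. Qed.

Fact uenv_scaleDr : right_distributive uenv_scale +%R.
Proof.
move=> a; elim/ucls_ind=> s; elim/ucls_ind=> t.
by rewrite /GRing.add /= !uclsE; apply/uclsP/ueq_scaleDr.
Qed.

Fact uenv_scaleDl u : {morph uenv_scale^~ u : a b / a + b}.
Proof.
elim/ucls_ind: u => s a b.
by rewrite [RHS]/GRing.add /= !uclsE; apply/uclsP/ueq_scaleDl.
Qed.

HB.instance Definition _ := GRing.Zmodule_isLmodule.Build K uenv
  uenv_scaleA uenv_scale1 uenv_scaleDr uenv_scaleDl.

Fact uenv_scaleAl a (u v : uenv) : a *: (u * v) = (a *: u) * v.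
Proof.
elim/ucls_ind: u => s; elim/ucls_ind: v => t.
rewrite /GRing.mul /GRing.scale /= !uclsE; exact/uclsP/ueq_scaleAl.
Qed.

HB.instance Definition _ := GRing.Lmodule_isLalgebra.Build K uenv uenv_scaleAl.

Fact uenv_scaleAr a (u v : uenv) : a *: (u * v) = u * (a *: v).
Proof.
elim/ucls_ind: u => s; elim/ucls_ind: v => t.
rewrite /GRing.mul /GRing.scale /= !uclsE; exact/uclsP/ueq_scaleAr.
Qed.

HB.instance Definition _ := GRing.Lalgebra_isAlgebra.Build K uenv uenv_scaleAr.

Definition uenv_in (x : L) : uenv := ucls (UGen x).

Lemma uclsDE s t : ucls (UAdd s t) = ucls s + ucls t.
Proof. by rewrite -ucls_add. Qed.

Lemma uclsME s t : ucls (UMul s t) = ucls s * ucls t.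
Proof. by rewrite -ucls_mul. Qed.

Lemma uclsZE a s : ucls (UScale a s) = a *: ucls s.
Proof. by rewrite -ucls_scale. Qed.

Fact uenv_in_linear : linear uenv_in.
Proof.
by move=> a x y; rewrite /uenv_in -uclsZE -uclsDE; apply/uclsP/ueq_gen_lin.
Qed.

HB.instance Definition _ :=
  GRing.isLinear.Build K L uenv _ uenv_in uenv_in_linear.

Lemma uenv_in_br x y :
  uenv_in (br x y) = uenv_in x * uenv_in y - uenv_in y * uenv_in x.
Proof.
by rewrite -scaleN1r /uenv_in -!uclsME -uclsZE -uclsDE; apply/uclsP/ueq_gen_br.
Qed.

Lemma uenv_universal (B : algType K) (f : {linear L -> B}) :
    (forall x y, f (br x y) = f x * f y - f y * f x) ->
  exists g : {lrmorphism uenv -> B},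
    (forall x, g (uenv_in x) = f x) /\
    (forall h : {lrmorphism uenv -> B},
       (forall x, h (uenv_in x) = f x) -> h =1 g).
Proof.
move=> fbr; pose g (u : uenv) := ueval f (repr u).
have gE t : g (ucls t) = ueval f t.
  by apply: ueval_eq fbr (ucls_repr t); apply: linearP.
have glin : linear g.
  move=> a; elim/ucls_ind=> s; elim/ucls_ind=> t.
  by rewrite -uclsZE -uclsDE !gE.
have gmul : monoid_morphism g.
  split=> [|]; first exact: (gE UOne).
  elim/ucls_ind=> s; elim/ucls_ind=> t.
  by rewrite -uclsME !gE.
pose gL := GRing.isLinear.Build K uenv B _ g glin.
pose gM := GRing.isMonoidMorphism.Build uenv B g gmul.
pose G : {lrmorphism uenv -> B} := HB.pack g gL gM.
exists G; split=> [x|h hE]; first exact: (gE (UGen x)).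
elim/ucls_ind=> t; rewrite [RHS]gE.
elim: t => [x|||s IHs t IHt|s IHs t IHt|a s IHs] /=.
- exact: hE.
- exact: (raddf0 h).
- exact: (rmorph1 h).
- by rewrite uclsDE -IHs -IHt; apply: (raddfD h).
- by rewrite uclsME -IHs -IHt; apply: (rmorphM h).
- by rewrite uclsZE -IHs; apply: (linearZZ h).
Qed.

End UniversalEnvelopingAlgebra.

Definition gl_br (K : comNzRingType) (m : nat) (A B : 'M[K]_m) : 'M[K]_m :=
  A *m B - B *m A.

Definition Ugl (R : realType) (m : nat) : algType R[i] := uenv (@gl_br R[i] m).

Section GlPowers.
Variables (R : realType) (m : nat).
Local Notation U := (Ugl R m).

Definition egl (k l : 'I_m) : U := uenv_in (@gl_br R[i] m) (delta_mx k l).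

(* The index sequence k, i_1, ..., i_(q-1), l is k :: rcons i l. The ordered *)
(* product runs over its consecutive pairs, from left to right.               *)
Definition epow (q : nat) (k l : 'I_m) : U :=
  if q is q'.+1 then
    \sum_(i : q'.-tuple 'I_m) \prod_(j < q'.+1)
      egl (nth k (k :: rcons i l) j) (nth k (k :: rcons i l) j.+1)
  else (k == l)%:R.

Definition etpow (q : nat) (k l : 'I_m) : U :=
  if q is q'.+1 then
    (-1) ^+ q'.+1 * \sum_(i : q'.-tuple 'I_m) \prod_(j < q'.+1)
      egl (nth k (k :: rcons i l) j.+1) (nth k (k :: rcons i l) j)
  else (k == l)%:R.

Definition cas (q : nat) : U := \sum_(k < m) epow q k k.

Definition tcas (q : nat) : U := \sum_(k < m) etpow q k k.

(* Kneg n c is K_n(-c). The exponent i_(j+1) of c_j is i j; the constraint    *)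
(* i_1 + 2 i_2 + ... + n i_n = n forces every i_j <= n, so letting the        *)
(* exponents range over 'I_n.+1 loses nothing.                                *)
Definition Kneg (n : nat) (c : nat -> U) : U :=
  \sum_(i : {ffun 'I_n -> 'I_n.+1} | (\sum_(j < n) j.+1 * i j)%N == n)
    (((\sum_(j < n) i j)`!)%N%:R / (\prod_(j < n) (i j)`!)%N%:R : R[i]) *:
      \prod_(j < n) c j ^+ i j.

End GlPowers.

(* Main.v *)
(* Let E = (e_ij) be the matrix of generators of U(gl_m). Then e_kl^q is the  *)
(* (k,l) entry of E^q, and te_kl^q that of (-E^T)^q, so the left-hand side of *)
(* the first identity is the (k,l) entry of (-E^T - m)^q. From                *)
(*   [e_ij, (E^p)_kl] = delta_jk (E^p)_il - delta_il (E^p)_kj                 *)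
(* the traces c_p of E^p (the Casimir elements) are central, and multiplying  *)
(* by -E^T - m sends the transpose of E^p to minus that of E^(p+1) + c_p. The *)
(* identity follows by induction on q since K_(n+1) = sum_p K_(n-p) c_p.      *)
(* The second identity is the first one for -E^T, which satisfies the same    *)
(* commutation relations as E.                                                *)
Require Import Defs.
From mathcomp Require Import all_boot all_order all_algebra.
From mathcomp Require Import boolp reals complex ring.
Set Implicit Arguments.
Unset Strict Implicit.
Unset Printing Implicit Defensive.
Import GRing.Theory Num.Theory.
Local Open Scope ring_scope.

(** Everything takes place over an abstract algebra with a matrix E subject to [gl_relations]. There
    [gl_binomial_identity] evaluates (-E^T - m)^q twice. The binomial theorem gives one side,
    because the scalar matrix m commutes with E^T. Iterating [shifted_tr_mul_pow] gives the other:
    each step contributes a trace, and [multinom_sumS] identifies the accumulated coefficients with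
    K_n(-c). [mxpow_path_sum] translates matrix powers back into the sums defining e_kl^q. *)

(** * The polynomials K_n(-c) and their recurrence *)

Section MultinomialSums.
Variables (F : numFieldType) (A : algType F) (c : nat -> A).

Definition weight (N B : nat) (f : {ffun 'I_N -> 'I_B.+1}) : nat :=
  \sum_(j < N) j.+1 * f j.

Definition multinom_term (N B : nat) (f : {ffun 'I_N -> 'I_B.+1}) : A :=
  (((\sum_(j < N) f j)`!)%N%:R / (\prod_(j < N) (f j)`!)%N%:R : F) *:
    \prod_(j < N) c j ^+ f j.

(* K_n(-c) is multinom_sum n n n. Separate bounds on the number of variables *)
(* (N) and on the exponents (B) let the recurrence in n keep both fixed.      *)
Definition multinom_sum (N B n : nat) : A :=
  \sum_(f : {ffun 'I_N -> 'I_B.+1} | weight f == n) multinom_term f.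

Lemma commr_multinom_sum (x : A) N B n :
  (forall j, GRing.comm x (c j)) -> GRing.comm x (multinom_sum N B n).
Proof.
move=> xc; apply: commr_sum => f _; rewrite /multinom_term /GRing.comm.
rewrite -scalerAl -scalerAr; congr (_ *: _).
by apply: commr_prod => j _; apply/commrX/xc.
Qed.

Lemma multinom_sum0 N B : multinom_sum N B 0 = 1.
Proof.
rewrite /multinom_sum (big_pred1 [ffun=> ord0]) => [|f].
  rewrite /multinom_term !big1 ?divr1 ?scale1r // => j _; by rewrite ffunE.
rewrite sum_nat_eq0; apply/forallP/eqP => [f0|-> j]; last by rewrite ffunE muln0.
apply/ffunP => j; rewrite ffunE; apply/val_inj/eqP.
by move: (f0 j); rewrite muln_eq0.
Qed.

(** With [decr_at], the change of variables for the recurrence: mutually inverse between exponents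
    with [f j < B] and those with [0 < f j]. *)
Definition incr_at N B (j : 'I_N) (f : {ffun 'I_N -> 'I_B.+1}) :=
  [ffun i => inord (f i + (i == j)) : 'I_B.+1].

Definition decr_at N B (j : 'I_N) (f : {ffun 'I_N -> 'I_B.+1}) :=
  [ffun i => inord (f i - (i == j)) : 'I_B.+1].

Lemma incr_atE N B (j i : 'I_N) (f : {ffun 'I_N -> 'I_B.+1}) :
  (f j < B)%N -> incr_at j f i = (f i + (i == j))%N :> nat.
Proof.
move=> fB; rewrite ffunE inordK //.
by case: eqP => [->|_]; [rewrite addn1 ltnS|rewrite addn0 ltn_ord].
Qed.

Lemma decr_atK N B (j : 'I_N) (f : {ffun 'I_N -> 'I_B.+1}) :
  (0 < f j)%N -> incr_at j (decr_at j f) = f.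
Proof.
move=> f0; have E i : decr_at j f i = (f i - (i == j))%N :> nat.
  by rewrite ffunE inordK // (leq_ltn_trans (leq_subr _ _)).
apply/ffunP => i; rewrite ffunE E subnK ?inord_val //.
by case: eqP => [->|].
Qed.

Lemma incr_atK N B (j : 'I_N) (f : {ffun 'I_N -> 'I_B.+1}) :
  (f j < B)%N -> decr_at j (incr_at j f) = f.
Proof.
move=> fB; apply/ffunP => i; rewrite ffunE incr_atE // addnK.
exact: inord_val.
Qed.

Lemma weight_incr N B (j : 'I_N) (f : {ffun 'I_N -> 'I_B.+1}) :
  (f j < B)%N -> weight (incr_at j f) = (weight f + j.+1)%N.
Proof.
move=> fB; rewrite /weight (eq_bigr (fun i : 'I_N => i.+1 * f i + i.+1 * (i == j)))%N.
  rewrite big_split /= [X in (_ + X)%N](bigD1 j) //= eqxx muln1.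
  rewrite [X in (_ + (_ + X))%N]big1 ?addn0 //.
  by move=> i /negPf ->; rewrite muln0.
by move=> i _; rewrite incr_atE // mulnDr.
Qed.

Lemma sum_incr_at N B (j : 'I_N) (f : {ffun 'I_N -> 'I_B.+1}) :
  (f j < B)%N -> (\sum_(i < N) incr_at j f i)%N = (\sum_(i < N) f i).+1.
Proof.
move=> fB; rewrite (eq_bigr (fun i : 'I_N => f i + (i == j)))%N; last first.
  by move=> i _; apply: incr_atE.
rewrite big_split /= [X in (_ + X)%N](bigD1 j) //= eqxx.
rewrite [X in (_ + (_ + X))%N]big1 ?addn0 ?addn1 //.
by move=> i /negPf ->.
Qed.

Lemma leq_weight N B (j : 'I_N) (f : {ffun 'I_N -> 'I_B.+1}) : (f j <= weight f)%N.
Proof.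
rewrite /weight (bigD1 j) //=; apply: leq_trans (leq_addr _ _).
exact: leq_pmull.
Qed.

Hypothesis cC : forall i j, GRing.comm (c i) (c j).

(** The scalar cancels the new factors of (|f|+1)! and (f_j+1)!; commutativity moves the extra [c j]
    to the right end. *)
Lemma multinom_term_incr N B (j : 'I_N) (f : {ffun 'I_N -> 'I_B.+1}) :
  (f j < B)%N ->
  ((f j).+1%:R / (\sum_(i < N) f i).+1%:R : F) *: multinom_term (incr_at j f)
  = multinom_term f * c j.
Proof.
move=> fB.
have P : (\prod_(i < N) (incr_at j f i)`!)%N = ((f j).+1 * \prod_(i < N) (f i)`!)%N.
  rewrite (bigD1 j) //= [X in (_ * X)%N = _](eq_bigr (fun i => (f i)`!)); last first.
    by move=> i /negPf ij; rewrite incr_atE // ij addn0.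
  by rewrite incr_atE // eqxx addn1 factS -mulnA [in RHS](bigD1 j).
have X : \prod_(i < N) c i ^+ incr_at j f i = \prod_(i < N) c i ^+ f i * c j.
  rewrite (eq_bigr (fun i : 'I_N => c i ^+ f i * c j ^+ (i == j))) => [|i _].
    rewrite prodrM_comm => [|i k _ _]; last exact/commrX/commr_sym/commrX.
    congr (_ * _); rewrite prodrXr (bigD1 j) //= eqxx big1 ?addn0 ?expr1 //.
    by move=> i /negPf ->.
  by rewrite incr_atE // exprD; case: eqP => [->|]; rewrite ?expr0.
rewrite /multinom_term sum_incr_at // P X -scalerAl scalerA; congr (_ *: _).
rewrite factS !natrM invfM.
have N0 k : k.+1%:R != 0 :> F by rewrite pnatr_eq0.
have P0 : (\prod_(i < N) (f i)`!)%:R != 0 :> F.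
  by rewrite pnatr_eq0 -lt0n prodn_gt0 // => i; apply: fact_gt0.
by field; rewrite P0 !nat1r !N0.
Qed.

(* Pascal's rule for multinomial coefficients:                                *)
(*   |f|! / prod_i f_i! = sum_j (f_j / |f|) |f|! / prod_i f_i!,               *)
(* where the j-th summand is the multinomial coefficient of f lowered at j.   *)
Lemma multinom_sumS N B n : (n < N)%N -> (n < B)%N ->
  multinom_sum N B n.+1 = \sum_(j < n.+1) multinom_sum N B (n - j) * c j.
Proof.
move=> nN nB.
pose G (j : 'I_N) (f : {ffun 'I_N -> 'I_B.+1}) : A :=
  ((f j)%:R / (\sum_(i < N) f i)%:R : F) *: multinom_term f.
rewrite (big_ord_widen N (fun j => multinom_sum N B (n - j) * c j)) //.
(* The shares f_j / |f| of a term add up to 1, since weight n+1 forces |f| > 0; summands with f_j =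
   0 vanish. *)
transitivity (\sum_(j < N) \sum_(f : {ffun 'I_N -> 'I_B.+1} |
    (weight f == n.+1) && (0 < f j)%N) G j f).
  under eq_bigr => j _ do rewrite big_mkcondr.
  rewrite exchange_big /=; apply: eq_bigr => f wf.
  under eq_bigr => j _.
    have -> : (if (0 < f j)%N then G j f else 0) = G j f.
      by rewrite /G; case: (posnP (f j)) => [->|//]; rewrite mul0r scale0r.
    over.
  rewrite -scaler_suml -mulr_suml -natr_sum divff ?scale1r // pnatr_eq0.
  apply: contraL wf; rewrite sum_nat_eq0 => /forallP f0.
  by rewrite /weight big1 // => j _; rewrite (eqP (f0 j)) muln0.
rewrite [RHS]big_mkcond; apply: eq_bigr => j _.
(* For j > n, a positive f_j already gives weight at least j+1 > n+1, so the sum is empty. *)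
rewrite ltnS; case: leqP => [jn|nj]; last first.
  rewrite big1 // => f /andP[/eqP wf f0].
  have := wf; rewrite /weight (bigD1 j) //= => /eqP.
  rewrite gtn_eqF //; apply: leq_trans (leq_addr _ _).
  by apply: leq_trans (leq_pmulr _ f0).
(* At f j = B, inord wraps to 0. *)
have incr_at_gt0 (f : {ffun 'I_N -> 'I_B.+1}) : (0 < incr_at j f j)%N -> (f j < B)%N.
  rewrite ffunE eqxx addn1; case: (ltnP (f j) B) => // Bf.
  have -> // : inord (f j).+1 = ord0 :> 'I_B.+1.
  by apply: val_inj; rewrite val_insubd ltnS ltnNge Bf.
rewrite (reindex_onto (incr_at j) (decr_at j)) => [|f /andP[_]]; last exact: decr_atK.
rewrite /multinom_sum mulr_suml; apply: eq_big => f; last first.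
  move=> /andP[/andP[_ /incr_at_gt0 fB] _].
  by rewrite /G sum_incr_at // incr_atE // eqxx addn1 multinom_term_incr.
apply/idP/eqP => [/andP[/andP[/eqP wf /incr_at_gt0 fB] _]|wf].
  by move: wf; rewrite weight_incr // addnS => -[<-]; rewrite addnK.
have fB : (f j < B)%N.
  by apply: leq_ltn_trans nB; apply: leq_trans (leq_subr j _); rewrite -wf leq_weight.
by rewrite weight_incr // incr_atK // incr_atE // !eqxx addn1 wf addnS subnK ?eqxx.
Qed.

End MultinomialSums.

(** The recurrence expresses the sum through smaller weights without mentioning the bounds, so
    strong induction applies. *)
Lemma multinom_sum_trunc (F : numFieldType) (A : algType F) (c : nat -> A)
    (N B N' B' n : nat) :
  (forall i j, GRing.comm (c i) (c j)) ->
  (n <= N)%N -> (n <= B)%N -> (n <= N')%N -> (n <= B')%N ->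
  multinom_sum c N B n = multinom_sum c N' B' n.
Proof.
move=> cC; elim/ltn_ind: n => -[|n] IH nN nB nN' nB'; first by rewrite !multinom_sum0.
rewrite !multinom_sumS //; apply: eq_bigr => j _; congr (_ * _).
by apply: IH; rewrite ?ltnS ?leq_subr // (leq_trans (leq_subr _ _)) // ltnW.
Qed.

(** * Entries of matrix powers over a noncommutative ring *)

Lemma big_tcons (R : nmodType) (T : finType) q (G : q.+1.-tuple T -> R) :
  \sum_t G t = \sum_x \sum_(t : q.-tuple T) G [tuple of x :: t].
Proof.
rewrite pair_bigA (reindex (fun p : T * q.-tuple T => [tuple of p.1 :: p.2])) //.
exists (fun t => (thead t, [tuple of behead t])) => [[x t] _|t _] /=.
  by congr (_, _); apply: val_inj.
by rewrite [RHS]tuple_eta.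
Qed.

Lemma mxpow_path_sum (A : pzRingType) m (M : 'M[A]_m) q k l :
  (M ^+ q.+1) k l = \sum_(i : q.-tuple 'I_m) \prod_(j < q.+1)
      M (nth k (k :: rcons i l) j) (nth k (k :: rcons i l) j.+1).
Proof.
elim: q k => [|q IHq] k.
  rewrite (big_pred1 [tuple]) => [|t]; last exact/esym/eqP/tuple0.
  by rewrite big_ord1 expr1.
rewrite exprS mxE big_tcons; apply: eq_bigr => x _.
rewrite IHq mulr_sumr; apply: eq_bigr => i _; rewrite [RHS]big_ord_recl /=.
congr (_ * _); apply: eq_bigr => j _.
(* The induction hypothesis uses the default [x] for [nth], the goal uses [k]; the indices stay in
   range. *)
have sj : (j < size (x :: rcons i l))%N by rewrite /= size_rcons size_tuple leqW.
rewrite (set_nth_default k) //=; congr (M _ _).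
by apply: set_nth_default; rewrite size_rcons size_tuple.
Qed.

Lemma scalar_mx_exp (A : pzRingType) m (a : A) n :
  a%:M ^+ n = (a ^+ n)%:M :> 'M[A]_m.
Proof. by elim: n => // n IHn; rewrite !exprS IHn scalar_mxM. Qed.

Lemma commr_mxpow (A : pzRingType) m (M : 'M[A]_m) (x : A) p k l :
  (forall i j, GRing.comm x (M i j)) -> GRing.comm x ((M ^+ p) k l).
Proof.
move=> xM; elim: p k => [|p IHp] k; first by rewrite mxE; apply: commr_nat.
by rewrite exprS mxE; apply: commr_sum => s _; apply: commrM.
Qed.

(** * Matrices satisfying the commutation relations of gl_m *)

Section GlRelations.
Variables (A : pzRingType) (m : nat).
Implicit Types E : 'M[A]_m.

Definition gl_relations E := forall i j k l,
  E i j * E k l - E k l * E i j = E i l *+ (j == k) - E k j *+ (i == l).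

(** This reflects the automorphism X -> -X^T of gl_m. *)
Lemma gl_relationsN_tr E : gl_relations E -> gl_relations (- E^T).
Proof.
move=> EE i j k l; rewrite !mxE !mulrNN EE.
by rewrite !mulNrn opprK addrC.
Qed.

Variable E : 'M[A]_m.
Hypothesis EE : gl_relations E.

(** The commutator with [E i j] is a derivation. In the Leibniz expansion of E * E^p, the two middle
    terms E_kj (E^p)_il cancel. *)
Lemma gl_relations_pow p i j k l :
  E i j * (E ^+ p) k l - (E ^+ p) k l * E i j
  = (E ^+ p) i l *+ (j == k) - (E ^+ p) k j *+ (i == l).
Proof.
elim: p k l => [|p IHp] k l.
  rewrite !mxE mulr_natl mulr_natr subrr -!mulrnA mulnC [k == j]eq_sym.
  by rewrite subrr.
have D x y : (E ^+ p.+1) x y = \sum_s E x s * (E ^+ p) s y by rewrite exprS mxE.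
have comm s : E i j * (E k s * (E ^+ p) s l) - E k s * (E ^+ p) s l * E i j
    = E i s * (E ^+ p) s l *+ (j == k) - E k j * (E ^+ p) s l *+ (i == s)
      + (E k s * (E ^+ p) i l *+ (j == s) - E k s * (E ^+ p) s j *+ (i == l)).
  rewrite -!mulrnAr -mulrBr -IHp mulrBr !mulrA !mulrnAr -!mulrnAl -mulrBl -EE.
  by rewrite mulrBl addrA subrK.
rewrite !D mulr_sumr mulr_suml -sumrB (eq_bigr _ (fun s _ => comm s)).
have pick a (x : 'I_m -> A) : \sum_s x s *+ (a == s) = x a.
  rewrite (bigD1 a) //= eqxx big1 ?addr0 // => s.
  by rewrite eq_sym => /negPf ->.
by rewrite big_split /= !sumrB !pick addrA subrK !sumrMnl.
Qed.

Definition trpow p : A := \tr (E ^+ p).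

Lemma trpow_central p i j : GRing.comm (E i j) (trpow p).
Proof.
apply/eqP; rewrite -subr_eq0 mulr_sumr mulr_suml -sumrB.
under eq_bigr => k _ do rewrite gl_relations_pow.
rewrite sumrB (bigD1 j) //= eqxx [X in _ - X](bigD1 i) //= eqxx.
rewrite !big1 ?addr0 ?subrr // => k /negPf; first by rewrite eq_sym => ->.
by rewrite eq_sym => ->.
Qed.

(** In E_ik (E^p)_li the factors are in the wrong order for E^(p+1). Swapping them and summing over
    i adds delta_kl c_p - m (E^p)_lk; the shift by -m is chosen to cancel the last term. *)
Lemma shifted_tr_mul_pow p k l :
  \sum_i (- E^T - m%:R%:M) k i * (E ^+ p) l i
  = - ((E ^+ p.+1) l k + trpow p *+ (k == l)).
Proof.
under eq_bigr => i _ do rewrite !mxE mulrDl !mulNr -opprD.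
rewrite sumrN; congr (- _); rewrite big_split /=.
have -> : \sum_i E i k * (E ^+ p) l i
    = (E ^+ p.+1) l k + trpow p *+ (k == l) - m%:R * (E ^+ p) l k.
  have nE (x : A) : m%:R * x = \sum_(i < m) x by rewrite sumr_const card_ord mulr_natl.
  rewrite exprSr mxE nE -sumrMnl -big_split -sumrB /=; apply: eq_bigr => i _.
  have := gl_relations_pow p i k l i; rewrite eqxx mulr1n [k == l]eq_sym => /eqP.
  by rewrite subr_eq => /eqP ->; rewrite [LHS]addrC [LHS]addrA.
rewrite (bigD1 k) //= eqxx mulr1n big1 ?addr0 ?subrK // => i.
by rewrite eq_sym => /negPf ->; rewrite mul0r.
Qed.

Lemma shifted_tr_pow (K : nat -> A) q k l :
  K 0%N = 1 -> (forall n, K n.+1 = \sum_(p < n.+1) K (n - p)%N * trpow p) ->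
  (forall n i j, GRing.comm (E i j) (K n)) ->
  ((- E^T - m%:R%:M) ^+ q) k l
  = (-1) ^+ q * \sum_(p < q.+1) K (q - p)%N * (E ^+ p) l k.
Proof.
move=> K0 KS KC; elim: q k => [|q IHq] k.
  by rewrite big_ord1 K0 !mul1r !mxE eq_sym.
rewrite exprS mxE.
have GK i n : GRing.comm ((- E^T - m%:R%:M) k i) (K n).
  rewrite !mxE; apply/commr_sym/commrB; apply/commr_sym.
    by apply/commr_sym/commrN/commr_sym.
  by apply/commr_sym/commrMn/commr_nat.
under eq_bigr => i _.
  rewrite IHq mulrA (commr_sign _ _) -mulrA mulr_sumr.
  under eq_bigr => p _ do rewrite mulrA GK -mulrA.
  over.
rewrite -mulr_sumr exchange_big /= exprSr -mulrA mulN1r; congr (_ * _).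
under eq_bigr => p _ do rewrite -mulr_sumr shifted_tr_mul_pow mulrN.
rewrite sumrN; congr (- _).
(* By the recurrence, the trace terms assemble into K_(q+1), the summand p = 0; the others are the
   summands p+1. *)
rewrite [RHS]big_ord_recl subn0 KS !mxE eq_sym mulr_natr -sumrMnl addrC -big_split /=.
by apply: eq_bigr => p _; rewrite mulrDr; congr (_ + _); apply: mulrnAr.
Qed.

End GlRelations.

(** * The identity for an abstract matrix, then for the generators of U(gl_m) *)

Lemma gl_binomial_identity (F : numFieldType) (A : algType F) m (E : 'M[A]_m) q k l :
  gl_relations E ->
  \sum_(p < q.+1) 'C(q, p)%:R * (- m%:R) ^+ (q - p) * ((- E^T) ^+ p) k l
  = (-1) ^+ q * \sum_(p < q.+1)
      multinom_sum (trpow E) (q - p) (q - p) (q - p) * (E ^+ p) l k.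
Proof.
move=> EE; pose K n := multinom_sum (trpow E) n n n.
have tE := trpow_central EE.
have tt i j : GRing.comm (trpow E i) (trpow E j).
  apply: commr_sum => s _; apply: commr_mxpow => a b.
  exact/commr_sym/trpow_central.
rewrite -(shifted_tr_pow EE (K := K)) //; first last.
- by move=> n i j; apply: commr_multinom_sum.
- move=> n; rewrite /K multinom_sumS //; apply: eq_bigr => p _; congr (_ * _).
  by apply: multinom_sum_trunc; rewrite ?leq_subr // leqW // leq_subr.
- exact: multinom_sum0.
have natM : (m%:R : A)%:M = m%:R :> 'M_m by rewrite -scalemx1 scaler_nat.
have NM : - (m%:R : A)%:M = (- m%:R)%:M :> 'M_m by rewrite raddfN.
rewrite addrC exprDn_comm; last by apply/commr_sym/commrN; rewrite natM; apply: commr_nat.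
rewrite summxE; apply: eq_bigr => p _.
rewrite -mulrA mulr_natl mulmxnE NM scalar_mx_exp -mulmxE mul_scalar_mx.
by rewrite mxE.
Qed.

Section GlGenerators.
Variables (R : realType) (m : nat).
Local Notation U := (Ugl R m).

Definition egl_mx : 'M[U]_m := \matrix_(i, j) egl R i j.

Lemma egl_mx_relations : gl_relations egl_mx.
Proof.
move=> i j k l; rewrite !mxE -uenv_in_br /gl_br !mul_delta_mx_cond raddfB /= !raddfMn.
by rewrite [l == i]eq_sym.
Qed.

Lemma epowE q k l : epow R q k l = (egl_mx ^+ q) k l.
Proof.
case: q => [|q]; first by rewrite mxE.
rewrite mxpow_path_sum; apply: eq_bigr => i _; apply: eq_bigr => j _.
by rewrite mxE.
Qed.

(** Entries do not commute, so this is a power of the transpose, not the transpose of a power: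
    indices swap within each factor while the order of the factors is kept. *)
Lemma etpowE q k l : etpow R q k l = ((- egl_mx^T) ^+ q) k l.
Proof.
case: q => [|q]; first by rewrite mxE.
rewrite exprNn /etpow.
have -> : (-1 : 'M[U]_m) ^+ q.+1 = ((-1) ^+ q.+1)%:M.
  by rewrite -scalar_mx_exp raddfN.
rewrite -mulmxE mul_scalar_mx mxE mxpow_path_sum; congr (_ * _).
apply: eq_bigr => i _; apply: eq_bigr => j _.
by rewrite !mxE.
Qed.

Lemma cas_tr : @cas R m = trpow egl_mx.
Proof. by apply/funext => p; apply: eq_bigr => k _; rewrite epowE. Qed.

Lemma tcas_tr : @tcas R m = trpow (- egl_mx^T).
Proof. by apply/funext => p; apply: eq_bigr => k _; rewrite etpowE. Qed.

End GlGenerators.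

Theorem theorem5p3 (R : realType) (m : nat) (m_ge1 : (1 <= m)%N)
    (q : nat) (k l : 'I_m) :
  \sum_(p < q.+1) 'C(q, p)%:R * (- m%:R) ^+ (q - p) * etpow R p k l
    = (-1) ^+ q * \sum_(p < q.+1) Kneg (q - p) (@cas R m) * epow R p l k
  /\
  \sum_(p < q.+1) 'C(q, p)%:R * (- m%:R) ^+ (q - p) * epow R p k l
    = (-1) ^+ q * \sum_(p < q.+1) Kneg (q - p) (@tcas R m) * etpow R p l k.
Proof.
split.
  under eq_bigr => p _ do rewrite etpowE.
  under [in RHS]eq_bigr => p _ do rewrite epowE cas_tr.
  exact: (gl_binomial_identity q k l (@egl_mx_relations R m)).
have EK : egl_mx R m = - (- (egl_mx R m)^T)^T by rewrite raddfN /= opprK trmxK.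
under eq_bigr => p _ do rewrite epowE EK.
under [in RHS]eq_bigr => p _ do rewrite etpowE tcas_tr.
exact/gl_binomial_identity/gl_relationsN_tr/egl_mx_relations.
Qed.
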